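(* There is a sufficiently large constant $c>0$ such that, uniformly over all $n$ with $s\ge2$ and $\lambda-\lambda_2\ge c$, $$d_{\mathrm{TV}}(\mathscr{L}(X_n),\mathscr{L}(Y_\lambda))\asymp\frac{1}{2^{\lambda-\lambda_2}}\min\left\{1,\frac{\lambda-\lambda_2}{\sqrt{\lambda}}\right\},$$ i.e. the left-hand side is bounded above and below by positive absolute constants times the right-hand side.
   Context: For a positive integer $n$, write $n=2^{\lambda_1}+2^{\lambda_2}+\cdots+2^{\lambda_s}$ with $\lambda=\lambda_1>\lambda_2>\cdots>\lambda_s\ge0$ (so $\lambda=\lfloor\log_2 n\rfloor$). $X_n$ is the number of 1s in the binary representation of an integer chosen uniformly at random from $\{0,1,\ldots,n-1\}$; $Y_\lambda\sim\mathrm{Binom}(\lambda,1/2)$; $d_{\mathrm{TV}}(\mathscr{L}(Z),\mathscr{L}(W))=\frac12\sum_k|\mathbb{P}(Z=k)-\mathbb{P}(W=k)|$. *)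

(* Defs.v *)
From HB Require Import structures.
From mathcomp Require Import all_boot all_order all_algebra.
From mathcomp Require Import all_classical all_reals all_analysis.

Set Implicit Arguments.
Unset Strict Implicit.
Unset Printing Implicit Defensive.

Import Order.TTheory GRing.Theory Num.Theory.
Import numFieldNormedType.Exports.

Local Open Scope classical_set_scope.
Local Open Scope ring_scope.

(* The range 'i < m' covers every binary digit of m because m < 2 ^ m. *)
Definition num_ones (m : nat) : nat := (\sum_(i < m) odd (m %/ 2 ^ i))%N.

Lemma measurable_num_ones : measurable_fun [set: nat] num_ones.
Proof. by []. Qed.

HB.instance Definition _ :=
  isMeasurableFun.Build _ _ _ _ num_ones measurable_num_ones.

Section uniform_below.
Local Open Scope ereal_scope.
Context {R : realType}.
Variable n : nat.

(* Uniform distribution on {0, ..., n - 1}; the value at n = 0 is a default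
   that makes it a probability measure for every n. *)
Definition uniform_below (U : set nat) : \bar R :=
  if n is 0%N then \d_0%N U else (n%:R^-1)%R%:E * \sum_(k < n) \d_(k : nat) U.

Let uniform_below_mscale : (0 < n)%N ->
  uniform_below = mscale (n%:R^-1)%:nng%R (msum (fun k : nat => \d_k) n).
Proof. by rewrite /uniform_below; case: n. Qed.

Let uniform_below_dirac : n = 0%N -> uniform_below = \d_0%N.
Proof. by rewrite /uniform_below => ->. Qed.

Let uniform_below0 : uniform_below set0 = 0.
Proof.
have [/uniform_below_dirac ->|/uniform_below_mscale ->] := posnP n;
  exact: measure0.
Qed.

Let uniform_below_ge0 U : 0 <= uniform_below U.
Proof.
have [/uniform_below_dirac ->|/uniform_below_mscale ->] := posnP n;
  exact: measure_ge0.
Qed.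

Let uniform_below_sigma_additive : semi_sigma_additive uniform_below.
Proof.
have [/uniform_below_dirac ->|/uniform_below_mscale ->] := posnP n;
  exact: measure_semi_sigma_additive.
Qed.

HB.instance Definition _ := isMeasure.Build _ _ _ uniform_below
  uniform_below0 uniform_below_ge0 uniform_below_sigma_additive.

Let uniform_below_setT : uniform_below [set: nat] = 1.
Proof.
have [/uniform_below_dirac ->|n0] := posnP n; first exact: probability_setT.
rewrite uniform_below_mscale // /mscale/= /msum.
rewrite (eq_bigr (fun=> 1)) => [|k _]; last exact: probability_setT.
by rewrite sumEFin sumr_const card_ord -EFinM mulVf// pnatr_eq0 -lt0n.
Qed.

HB.instance Definition _ :=
  @Measure_isProbability.Build _ _ R uniform_below uniform_below_setT.

End uniform_below.

Definition law_X (R : realType) (n : nat) : probability nat R :=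
  distribution (uniform_below n) num_ones.

Definition law_Y (R : realType) (lambda : nat) : probability nat R :=
  binomial_prob lambda (2^-1 : R).

Definition dTV (R : realType) (mu nu : probability nat R) : \bar R :=
  ((2^-1)%R%:E * \sum_(k <oo) `|mu [set k] - nu [set k]|)%E.

Definition binary_exponents (n : nat) (l : seq nat) : Prop :=
  sorted gtn l /\ n = (\sum_(i <- l) 2 ^ i)%N.

(* Main.v *)
Require Import Defs.
From mathcomp Require Import all_boot all_order all_algebra.
From mathcomp Require Import all_classical all_reals all_analysis.
From mathcomp Require Import ring lra zify.
Import Order.TTheory GRing.Theory Num.Theory.
Local Open Scope ring_scope.

Set Implicit Arguments.
Unset Strict Implicit.

(** Write d for the gap between the two leading exponents u + d and u of n, put
L = u + d, and let s(x) be the number of ones of x. Then n = 2^L + m with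
2^u <= m < 2^(u+1). On the first 2^L integers s has exactly the law of Y_L, and
on the remaining m integers it is 1 + s(x), x < m. Hence, for every test
function f,
  E f(X_n) - E f(Y_L) = 1/n * sum_(x < m) (f (1 + s x) - E f(Y_L)),
and the distance to estimate is half the supremum of this over |f| <= 1
([dTV_ge_mean_gap], [dTV_le_mean_gap], [mean_gap_top]). The prefactor m/n is of
order 2^-d; what is left is to see that the average over x < m can be made as
large as min(1, d / sqrt L), and no larger, up to constants.

Upper bound. A shift by one, or one more fair toss, changes E f(Y_a) by
O(1 / sqrt (a+1)) ([binom_mean_shift], [binom_mean_toss]), so that
E f(k + Y_a) - E f(Y_L) = O((L - a + k) / sqrt L) ([binom_mean_close]). Cutting
[0, m) into dyadic blocks according to the binary digits of m, the digit sum on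
each block is a shifted binomial. The lengths of the blocks decay geometrically
while L - a and k grow at most linearly, so the first block, where
L - a + k = d + 1, determines the order ([num_ones_discrepancy]).

Lower bound. Take f(j) = sin (t (L/2 - j)) with t = 1 / (16 max(d, sqrt L)).
By symmetry E f(Y_L) = 0, and a dyadic block has the closed form
[sum_sin_num_ones_pow2], in which the randomness only enters through a power of
cos (t/2). The first block contributes sin (t (d/2 - 1)) times a factor at least
1/2, which is of order t d = min(1, d / sqrt L) / 16. All other blocks together
lose at most 2^u t (t d^2 / 2 + 5) ([sum_sin_num_ones_ge]), which is a fraction of
the main term as soon as d is large. *)

(** * Elementary bounds on sine and cosine *)

Section Trigonometry.
Import numFieldNormedType.Exports.
Context {R : realType}.
Implicit Types x y : R.

Lemma sin_cos_MVT y : 0 <= y -> exists2 z, 0 <= z <= y & sin y = y * cos z.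
Proof.
move=> y0.
have dsin x : x \in `]0, y[ -> is_derive x 1 sin (cos x).
  by move=> _; exact: is_derive_sin.
have csin : {within `[0, y]%classic, continuous (@sin R)}%classic.
  by apply: continuous_subspaceT; exact: continuous_sin.
have [z zy] := MVT_segment y0 dsin csin.
by rewrite sin0 !subr0 mulrC => ?; exists z.
Qed.

Lemma norm_sin_le y : `|sin y| <= `|y|.
Proof.
suff pos (z : R) : 0 <= z -> `|sin z| <= z.
  have [y0|/ltW y0] := leP 0 y; first by rewrite (ger0_norm y0) pos.
  by rewrite (ler0_norm y0) -normrN -sinN pos ?oppr_ge0.
move=> z0; have [t _ ->] := sin_cos_MVT z0.
by rewrite normrM (ger0_norm z0) ler_piMr ?cos_max.
Qed.

Lemma cos_ge_quadratic x : 1 - x ^+ 2 / 2 <= cos x.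
Proof.
have -> : cos x = 1 - sin (x / 2) ^+ 2 *+ 2.
  rewrite {1}(_ : x = (x / 2) *+ 2) ?cos_mulr2n ?sin2cos2; lra.
have : sin (x / 2) ^+ 2 <= (x / 2) ^+ 2.
  rewrite -(real_normK (num_real (sin _))) -(real_normK (num_real (x / 2))).
  by rewrite lerXn2r ?nnegrE ?norm_sin_le.
by rewrite expr_div_n => ?; lra.
Qed.

(** Meant for all y >= 0, including those beyond pi: large deviations then cost
only a quadratic error, which the geometric weights of the blocks absorb. *)
Lemma sin_ge_quadratic y : 0 <= y -> y - y ^+ 2 <= sin y.
Proof.
move=> y0; have [z /andP[z0 zy] ->] := sin_cos_MVT y0.
have cz : 1 - z <= cos z.
  have quad := cos_ge_quadratic z; have ge1 := cos_geN1 z.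
  by have [z2|z2] := lerP z 2; nra.
by nra.
Qed.

End Trigonometry.

(** * Binary digit sums *)

Section BinaryDigits.
Context {R : realType}.
Local Open Scope nat_scope.

Lemma num_ones_widen M m : m < 2 ^ M -> num_ones m = \sum_(i < M) odd (m %/ 2 ^ i).
Proof.
have widen a b : a <= b -> m < 2 ^ a ->
    \sum_(i < b) odd (m %/ 2 ^ i) = \sum_(i < a) odd (m %/ 2 ^ i).
  move=> ab ma; rewrite -!(big_mkord xpredT (fun i => odd (m %/ 2 ^ i) : nat)).
  rewrite (big_cat_nat (n := a)) //= [X in _ + X]big_nat_cond [X in _ + X]big1 ?addn0 //.
  move=> i /andP[/andP[ai _] _].
  by rewrite divn_small // (leq_trans ma) // leq_exp2l.
move=> mM; rewrite /num_ones.
have [mM'|/ltnW mM'] := leqP m M; first by rewrite (widen _ _ mM') // ltn_expl.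
by rewrite [LHS](widen _ _ mM').
Qed.

(** Below the top bit of 2^a + x the digits are those of x, because the lower
quotients of 2^a are even. *)
Lemma num_ones_top a x : x < 2 ^ a -> num_ones (2 ^ a + x) = (num_ones x).+1.
Proof.
move=> xa; rewrite (@num_ones_widen a.+1) ?(@num_ones_widen a x xa); last first.
  by rewrite expnS mul2n -addnn ltn_add2l.
rewrite big_ord_recr /= divnDl // divnn expn_gt0 /= divn_small // addn0 addn1.
congr _.+1; apply: eq_bigr => i _.
have dvd2 : 2 ^ i.+1 %| 2 ^ a by rewrite dvdn_exp2l.
have dvdi : 2 ^ i %| 2 ^ a by rewrite dvdn_exp2l // ltnW.
rewrite divnDl // oddD (_ : odd (2 ^ a %/ 2 ^ i) = false) //.
by rewrite -expnB ?(ltnW (ltn_ord i)) // oddX subn_eq0 leqNgt ltn_ord.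
Qed.

(** The dyadic cut on which every induction below rests: dropping the leading
bit from the integers above 2^a lowers their digit sum by one. *)
Lemma sum_num_ones_top (F : nat -> R) a m : m <= 2 ^ a ->
  (\sum_(x < 2 ^ a + m) F (num_ones x) =
   \sum_(x < 2 ^ a) F (num_ones x) + \sum_(x < m) F (num_ones x).+1)%R.
Proof.
move=> ma; rewrite big_split_ord /=; congr (_ + _)%R.
apply: eq_bigr => x _; rewrite num_ones_top //.
exact: leq_trans (ltn_ord x) ma.
Qed.

Lemma num_ones_leq x : num_ones x <= x.
Proof.
rewrite /num_ones -[X in _ <= X]card_ord -sum1_card leq_sum // => i _.
by case: odd.
Qed.

Lemma top_exponent_bound a l : sorted gtn (a :: l) -> \sum_(i <- l) 2 ^ i < 2 ^ a.
Proof.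
elim: l a => [|b l IH] a /=; first by rewrite big_nil expn_gt0.
case/andP=> ba bl; rewrite big_cons.
apply: (@leq_trans (2 ^ b.+1)); last by rewrite leq_exp2l.
by rewrite expnS mul2n -addnn ltn_add2l; exact: IH.
Qed.

End BinaryDigits.

(** * Means under the fair binomial law *)

Section BinomialMean.
Context {R : realType}.
Implicit Types (f g : nat -> R) (a k L : nat).

(** The mean of f(k + Y_a) for Y_a binomial with parameters a and 1/2, built one
fair toss at a time so that its properties follow by induction on a; the closed
form is [binom_meanE]. *)
Fixpoint binom_mean a f k : R :=
  if a is a'.+1 then (binom_mean a' f k + binom_mean a' f k.+1) / 2 else f k.

Lemma eq_binom_mean a f g k : f =1 g -> binom_mean a f k = binom_mean a g k.
Proof. by move=> fg; elim: a k => [|a IH] k //=; rewrite !IH. Qed.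

Lemma binom_meanD a f g k :
  binom_mean a (fun j => f j + g j) k = binom_mean a f k + binom_mean a g k.
Proof. by elim: a k => [|a IH] k //=; rewrite !IH; lra. Qed.

Lemma binom_meanZ a c f k :
  binom_mean a (fun j => c * f j) k = c * binom_mean a f k.
Proof. by elim: a k => [|a IH] k //=; rewrite !IH; lra. Qed.

Lemma binom_mean_cst a c k : binom_mean a (fun=> c) k = c.
Proof. by elim: a k => [|a IH] k //=; rewrite !IH; lra. Qed.

Lemma norm_binom_mean_le a f g k :
  (forall j, `|f j| <= g j) -> `|binom_mean a f k| <= binom_mean a g k.
Proof.
move=> fg; elim: a k => [|a IH] k //=.
rewrite normrM normfV [`|2|]ger0_norm // ler_pM2r ?invr_gt0 //.
by rewrite (le_trans (ler_normD _ _)) // lerD.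
Qed.

Lemma binom_meanE a f k :
  binom_mean a f k = 2 ^- a * \sum_(j < a.+1) 'C(a, j)%:R * f (k + j)%N.
Proof.
elim: a k => [|a IH] k /=.
  by rewrite big_ord_recl big_ord0 addr0 bin0 addn0 expr0 invr1 !mul1r.
rewrite !IH -mulrDr mulrAC exprSr invfM; congr (_ * _).
rewrite [RHS]big_ord_recl /= bin0 mul1r addn0.
under [X in _ = _ + X]eq_bigr do rewrite /bump /= add1n binS natrD mulrDl.
rewrite big_split /= addrA; congr (_ + _).
  rewrite [RHS]addrC [in RHS]big_ord_recr /= bin_small // mul0r addr0 big_ord_recl /=.
  rewrite addrC bin0 mul1r addn0; congr (_ + _).
by apply: eq_bigr => j _; rewrite addSnnS.
Qed.

(** For c = 2k + a this is the variance of the sum of a independent fair signs. *)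
Lemma binom_mean_sqr a (c : R) k :
  binom_mean a (fun j => (2 * j%:R - c) ^+ 2) k = a%:R + (2 * k%:R + a%:R - c) ^+ 2.
Proof.
elim: a k => [|a IH] k /=; first by rewrite add0r addr0.
by rewrite !IH -[k.+1]addn1 -[a.+1]addn1 !natrD; field.
Qed.

(** Integrated form of the identity
(a+1) ('C(a, j-1) - 'C(a, j)) = (2j - (a+1)) 'C(a+1, j). It turns the difference
quotient of the binomial mean into a mean against a centred variable. *)
Lemma binom_mean_difference a f k :
  a.+1%:R * (binom_mean a f k.+1 - binom_mean a f k) =
  2 * binom_mean a.+1 (fun j => (2 * (j%:R - k%:R) - a.+1%:R) * f j) k.
Proof.
elim: a k => [|a IH] k.
  rewrite /= -[k.+1]addn1 natrD; lra.
have shiftl : binom_mean a.+1 (fun j => (2 * (j%:R - k%:R) - a.+2%:R) * f j) k =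
    binom_mean a.+1 (fun j => (2 * (j%:R - k%:R) - a.+1%:R) * f j) k
    - binom_mean a.+1 f k.
  rewrite -[- binom_mean _ f k]mulN1r -(binom_meanZ _ (-1)) -binom_meanD.
  apply: eq_binom_mean => j.
  by rewrite -[a.+2]addn1 natrD; ring.
have shiftr : binom_mean a.+1 (fun j => (2 * (j%:R - k%:R) - a.+2%:R) * f j) k.+1 =
    binom_mean a.+1 (fun j => (2 * (j%:R - k.+1%:R) - a.+1%:R) * f j) k.+1
    + binom_mean a.+1 f k.+1.
  rewrite -binom_meanD; apply: eq_binom_mean => j.
  by rewrite -[a.+2]addn1 -[k.+1]addn1 !natrD; ring.
have splitE g i n : binom_mean n.+1 g i = (binom_mean n g i + binom_mean n g i.+1) / 2 by [].
rewrite [in RHS]splitE shiftl shiftr.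
have := IH k; have := IH k.+1.
rewrite [binom_mean a.+1 f k]splitE [binom_mean a.+1 f k.+1]splitE.
by rewrite -[a.+2]addn1 natrD; lra.
Qed.

(** By [binom_mean_difference] the shift costs 2/N times the mean absolute value
of a sum of N = a+1 fair signs, and that is at most sqrt N because the variance
is N. *)
Lemma binom_mean_shift a f k : (forall j, `|f j| <= 1) ->
  `|binom_mean a f k.+1 - binom_mean a f k| <= 2 / Num.sqrt a.+1%:R.
Proof.
move=> f1; set N : R := a.+1%:R; set s := Num.sqrt N.
have N0 : 0 < N by rewrite ltr0n.
have s0 : 0 < s by rewrite sqrtr_gt0.
have ss : s * s = N by rewrite -expr2 sqr_sqrtr // ltW.
rewrite ler_pdivlMr // -(ler_pM2l s0) mulrCA ss mulrC.
rewrite -[X in X * _](gtr0_norm N0) -normrM binom_mean_difference -/N.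
rewrite normrM [`|2|]ger0_norm // [s * 2]mulrC ler_pM2l //.
(* With u the centred variable, |u| <= u^2 / (2 s) + s / 2, since s > 0. Both terms
   have mean s / 2 when s^2 = N. *)
pose h j := (2 * s)^-1 * (2 * j%:R - (2 * k%:R + N)) ^+ 2 + s / 2.
have hle j : `|(2 * (j%:R - k%:R) - N) * f j| <= h j.
  rewrite normrM (le_trans (ler_piMr _ (f1 j))) //.
  rewrite /h (_ : 2 * _ - (_ + _) = 2 * (j%:R - k%:R) - N); last by ring.
  move: (2 * _ - N) => u; rewrite -(real_normK (num_real u)).
  move: `|u| => {}u; rewrite -subr_ge0.
  have -> : (2 * s)^-1 * u ^+ 2 + s / 2 - u = (2 * s)^-1 * (u - s) ^+ 2.
    by field; rewrite gt_eqF.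
  by rewrite mulr_ge0 ?sqr_ge0 // invr_ge0 mulr_ge0 // ltW.
apply: le_trans (norm_binom_mean_le _ _ hle) _.
rewrite /h binom_meanD binom_meanZ binom_mean_sqr binom_mean_cst -/N.
rewrite (_ : 2 * _ + _ - _ = 0); last by ring.
by rewrite -ss le_eqVlt; apply/orP; left; apply/eqP; field; rewrite gt_eqF.
Qed.

(** The bound is of order 1 / sqrt (a+1); writing it as a difference of square
roots lets the sum over consecutive a telescope. *)
Lemma binom_mean_toss a f k : (forall j, `|f j| <= 1) ->
  `|binom_mean a f k - binom_mean a.+1 f k| <=
  2 * (Num.sqrt a.+1%:R - Num.sqrt a%:R).
Proof.
move=> f1; have := binom_mean_shift a k f1.
rewrite (_ : binom_mean a f k - _ = - (binom_mean a f k.+1 - binom_mean a f k) / 2);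
  last by rewrite /=; lra.
rewrite normrM normrN normfV [`|2|]ger0_norm //.
move: (`|_|) => e.
have s1_gt0 : 0 < Num.sqrt a.+1%:R :> R by rewrite sqrtr_gt0 ltr0n.
have s0_ge0 : 0 <= Num.sqrt a%:R :> R by rewrite sqrtr_ge0.
have ss0 : Num.sqrt a%:R ^+ 2 = a%:R :> R by rewrite sqr_sqrtr.
have ss1 : Num.sqrt a.+1%:R ^+ 2 = a%:R + 1 :> R by rewrite sqr_sqrtr // -natr1.
rewrite ler_pdivlMr // => es.
rewrite -(ler_pM2r s1_gt0); nra.
Qed.

(** Uniform down to a = 0, since
sqrt L - sqrt a = (L - a) / (sqrt L + sqrt a) <= (L - a) / sqrt L. *)
Lemma binom_mean_tosses a L f k : (0 < L)%N -> (a <= L)%N -> (forall j, `|f j| <= 1) ->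
  `|binom_mean a f k - binom_mean L f k| <= 2 * (L - a)%:R / Num.sqrt L%:R.
Proof.
move=> L0 aL f1.
have tele : `|binom_mean a f k - binom_mean L f k| <=
    2 * (Num.sqrt L%:R - Num.sqrt a%:R).
  elim: L aL {L0} => [|L IH]; first by rewrite leqn0 => /eqP ->; rewrite !subrr normr0 mulr0.
  rewrite leq_eqVlt => /predU1P[->|]; first by rewrite !subrr normr0 mulr0.
  rewrite ltnS => /IH IHL.
  have := binom_mean_toss L k f1.
  rewrite (_ : binom_mean a f k - binom_mean L.+1 f k =
    binom_mean a f k - binom_mean L f k + (binom_mean L f k - binom_mean L.+1 f k));
    last by ring.
  by move=> toss; apply: le_trans (ler_normD _ _) _; lra.
apply: le_trans tele _.
have sL : 0 < Num.sqrt L%:R :> R by rewrite sqrtr_gt0 ltr0n.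
have sa : 0 <= Num.sqrt a%:R :> R by rewrite sqrtr_ge0.
have ssa : Num.sqrt a%:R ^+ 2 = a%:R :> R by rewrite sqr_sqrtr.
have ssL : Num.sqrt L%:R ^+ 2 = L%:R :> R by rewrite sqr_sqrtr.
have saL : Num.sqrt a%:R <= Num.sqrt L%:R :> R by rewrite ler_wsqrtr // ler_nat.
rewrite ler_pdivlMr // natrB //; nra.
Qed.

Lemma binom_mean_close a L f k : (0 < L)%N -> (a <= L)%N -> (forall j, `|f j| <= 1) ->
  `|binom_mean a f k - binom_mean L f 0| <= 2 * (L - a + k)%:R / Num.sqrt L%:R.
Proof.
move=> L0 aL f1.
have sL : 0 < Num.sqrt L%:R :> R by rewrite sqrtr_gt0 ltr0n.
have shifts : `|binom_mean L f k - binom_mean L f 0| <= 2 * k%:R / Num.sqrt L%:R.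
  elim: k => [|k IH]; first by rewrite subrr normr0 mulr0 mul0r.
  have step : `|binom_mean L f k.+1 - binom_mean L f k| <= 2 / Num.sqrt L%:R.
    apply: le_trans (binom_mean_shift L k f1) _.
    by apply: ler_wpM2l => //; rewrite lef_pV2 ?posrE ?sqrtr_gt0 ?ltr0n // ler_wsqrtr // ler_nat.
  have -> : binom_mean L f k.+1 - binom_mean L f 0 =
    binom_mean L f k.+1 - binom_mean L f k + (binom_mean L f k - binom_mean L f 0) by ring.
  apply: le_trans (ler_normD _ _) _.
  by rewrite -[k.+1]add1n natrD mulrDr mulr1 mulrDl lerD.
have -> : binom_mean a f k - binom_mean L f 0 =
  binom_mean a f k - binom_mean L f k + (binom_mean L f k - binom_mean L f 0) by ring.
apply: le_trans (ler_normD _ _) _.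
by rewrite natrD mulrDr mulrDl lerD // binom_mean_tosses.
Qed.

(** The digits of a uniform x < 2^a are a independent fair tosses. *)
Lemma sum_num_ones_pow2 a f k :
  \sum_(x < 2 ^ a) f (k + num_ones x)%N = 2 ^+ a * binom_mean a f k.
Proof.
elim: a k => [|a IH] k.
  by rewrite big_ord_recl big_ord0 addr0 mul1r /num_ones big_ord0 addn0.
rewrite expnS mul2n -addnn (sum_num_ones_top (fun j => f (k + j)%N)) // IH.
under [X in _ + X]eq_bigr do rewrite -addSnnS.
by rewrite IH /= exprS; lra.
Qed.

End BinomialMean.

(** * Upper bound for digit-sum averages *)

Section UpperBound.
Context {R : realType}.

(** Induction on a. The leading block of a range between 2^a and 2^(a+1) is handled by
[binom_mean_close], the rest by the induction hypothesis with k replaced by k+1.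
The constant 3 is what makes the recursion close: with z = L - a + k, the bounds z
and z + 4 of two parts of length at most 2^a average to z + 2, which is the bound
for a + 1. *)
Lemma num_ones_discrepancy (f : nat -> R) (L a k m : nat) :
  (0 < L)%N -> (forall j, `|f j| <= 1) -> (a <= L)%N -> (m < 2 ^ a)%N ->
  `|\sum_(x < m) (f (k + num_ones x)%N - binom_mean L f 0)| <=
  2 ^+ a * (2 * (L - a + k + 3)%:R / Num.sqrt L%:R).
Proof.
move=> L0 f1; set c := binom_mean L f 0; set s := Num.sqrt _.
have s0 : 0 < s by rewrite sqrtr_gt0 ltr0n.
elim: a k m => [|a IH] k m aL.
  rewrite expn0 ltnS leqn0 => /eqP ->; rewrite big_ord0 normr0.
  by rewrite !mulr_ge0 // invr_ge0 ltW.
have La : (L - a = (L - a.+1).+1)%N by rewrite subnSK.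
have [ma _|am] := ltnP m (2 ^ a).
  apply: le_trans (IH k m (ltnW aL) ma) _; rewrite La exprS.
  rewrite [2 * 2 ^+ a]mulrC -!mulrA ler_pM2l ?exprn_gt0 // ler_pM2l //.
  rewrite mulrA ler_pM2r ?invr_gt0 //.
  by rewrite -!natrM ler_nat; lia.
rewrite expnS mul2n -addnn -(subnKC am) ltn_add2l.
set m' := (m - _)%N => m'a.
rewrite (sum_num_ones_top (fun j => f (k + j)%N - c)) ?(ltnW m'a) //.
under [X in _ + X]eq_bigr do rewrite -addSnnS.
apply: le_trans (ler_normD _ _) _.
apply: le_trans (lerD (lexx _) (IH k.+1 m' (ltnW aL) m'a)) _.
rewrite sumrB sum_num_ones_pow2 sumr_const card_ord -[c *+ _]mulr_natl natrX -mulrBr.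
rewrite normrM ger0_norm ?exprn_ge0 // -mulrDr [2 ^+ a.+1]exprS [2 * 2 ^+ a]mulrC -[_ * 2 * _]mulrA.
rewrite ler_pM2l ?exprn_gt0 //.
apply: le_trans (lerD (binom_mean_close k L0 (ltnW aL) f1) (lexx _)) _.
rewrite -/s -mulrDl mulrA ler_pM2r ?invr_gt0 // -mulrDr -natrD -!natrM ler_nat.
by rewrite La; lia.
Qed.

End UpperBound.

(** * Lower bound by a sine test function *)

Section LowerBound.
Context {R : realType}.
Implicit Types (t b v : R) (a m : nat).

(** Each toss averages sin at two points at distance t, which multiplies it by
cos (t/2) and moves the argument to the midpoint. *)
Lemma sum_sin_num_ones_pow2 a t b :
  \sum_(x < 2 ^ a) sin (t * (b - (num_ones x)%:R)) =
  (2 * cos (t / 2)) ^+ a * sin (t * (b - a%:R / 2)).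
Proof.
elim: a b => [|a IH] b.
  by rewrite big_ord_recl big_ord0 addr0 mul1r /num_ones big_ord0 mul0r.
rewrite expnS mul2n -addnn (sum_num_ones_top (fun j => sin (t * (b - j%:R)))) // IH.
under [X in _ + X]eq_bigr do rewrite -natr1 opprD addrCA addrC.
rewrite IH -mulrDr exprSr -mulrA; congr (_ * _).
set u := t * (b - a.+1%:R / 2).
have -> : t * (b - a%:R / 2) = u + t / 2 by rewrite /u -[a.+1]addn1 natrD; lra.
have -> : t * (b - 1 - a%:R / 2) = u - t / 2 by rewrite /u -[a.+1]addn1 natrD; lra.
by rewrite sinD sinB; ring.
Qed.

(** The sine is linearly bounded below on the negative side, so a block centred
on the wrong side of b costs this much. *)
Definition negpart v : R := Num.max 0 (- v).

Lemma mul_sin_ge (c t v : R) : 0 <= c <= 1 -> 0 <= t ->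
  - (t * (negpart v + t * v ^+ 2)) <= c * sin (t * v).
Proof.
move=> /andP[c0 c1] t0; rewrite /negpart.
have [v0|v0] := leP 0 v.
  have -> : Num.max 0 (- v) = 0 by apply/max_idPl; rewrite oppr_le0.
  have := sin_ge_quadratic (mulr_ge0 t0 v0).
  have : 0 <= t * v by rewrite mulr_ge0.
  by move: (sin _) => s tv sin_ge; have [s0|s0] := leP 0 s; nra.
have -> : Num.max 0 (- v) = - v by apply/max_idPr; rewrite oppr_ge0 ltW.
have := norm_sin_le (t * v).
rewrite normrM (ger0_norm t0) (ltr0_norm v0) ler_norml => /andP[sin_ge _].
have := mulr_ge0 t0 (mulr_ge0 t0 (sqr_ge0 v)).
by move: (sin _) sin_ge => s sin_ge; have [s0|s0] := leP 0 s; nra.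
Qed.

(** Dyadic induction on a, v being the signed distance from b to the mean a/2 of the digit
sum. The two parts of a range are centred at distance v + 1/2 and v - 1/2. The
coefficient 2 and the constant 5 absorb the resulting increase of the quadratic
and linear terms, thanks to the factor 1/2 gained at each level. *)
Lemma sum_sin_num_ones_ge a m t b : 0 < t <= 1 -> (m < 2 ^ a)%N ->
  let v := b - a%:R / 2 in
  - (2 ^+ a * (t * (negpart v + 2 * t * v ^+ 2 + 5))) <=
  \sum_(x < m) sin (t * (b - (num_ones x)%:R)).
Proof.
move=> /andP[t0 t1].
have neg_ge0 v : 0 <= negpart v by rewrite le_max lexx.
have cos01 : 0 <= cos (t / 2) <= 1.
  by rewrite cos_le1 andbT; apply: le_trans (cos_ge_quadratic _); nra.
elim: a m b => [|a IH] m b /=.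
  rewrite expn0 ltnS leqn0 => /eqP ->; rewrite big_ord0 oppr_le0 mul1r.
  rewrite pmulr_rge0 //; set v := b - _.
  by have := mulr_ge0 (ltW t0) (sqr_ge0 v); have := neg_ge0 v; lra.
set v := b - a.+1%:R / 2.
have vE : b - a%:R / 2 = v + 1 / 2 by rewrite /v -[a.+1]addn1 natrD; lra.
have pow0 : 0 < 2 ^+ a :> R by rewrite exprn_gt0.
have sqv : 0 <= v ^+ 2 by rewrite sqr_ge0.
have sq_up : (v + 1 / 2) ^+ 2 <= 5 / 4 * (v ^+ 2 + 1).
  by have := sqr_ge0 (v - 2); lra.
have sq_down : (v - 1 / 2) ^+ 2 <= 5 / 4 * (v ^+ 2 + 1).
  by have := sqr_ge0 (v + 2); lra.
have neg_up : negpart (v + 1 / 2) <= negpart v.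
  rewrite /negpart ge_max !le_max lexx /=; apply/orP; right; lra.
have neg_down : negpart (v - 1 / 2) <= negpart v + 1 / 2.
  have : - v <= negpart v by rewrite le_max lexx orbT.
  by have := neg_ge0 v; rewrite [negpart (_ - _)]/negpart ge_max => *; lra.
have negv := neg_ge0 v.
have [ma _|am] := ltnP m (2 ^ a).
  apply: le_trans (IH m b ma); rewrite vE lerN2 [2 ^+ a.+1]exprSr -[_ * 2 * _]mulrA ler_pM2l //.
  rewrite [2 * (t * _)]mulrCA ler_pM2l //; nra.
rewrite expnS mul2n -addnn -(subnKC am) ltn_add2l.
set m' := (m - _)%N => m'a.
rewrite (sum_num_ones_top (fun j => sin (t * (b - j%:R)))) ?(ltnW m'a) //.
under [X in _ <= _ + X]eq_bigr do rewrite -natr1 opprD addrCA addrC.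
apply: le_trans (lerD (lexx _) (IH m' (b - 1) m'a)).
rewrite sum_sin_num_ones_pow2 vE (_ : b - 1 - a%:R / 2 = v - 1 / 2); last by rewrite -addrAC vE; lra.
have cosa01 : 0 <= cos (t / 2) ^+ a <= 1.
  by case/andP: cos01 => c0 c1; rewrite exprn_ge0 //= exprn_ile1.
have main := mul_sin_ge (v + 1 / 2) cosa01 (ltW t0).
rewrite exprMn [2 ^+ a.+1]exprSr -![2 ^+ a * _ * _]mulrA -!(mulrN (2 ^+ a)) -mulrDr.
rewrite ler_pM2l //; apply: le_trans (lerD main (lexx _)).
rewrite -opprD -mulrDr [2 * (t * _)]mulrCA lerN2 ler_pM2l //; nra.
Qed.

Lemma bernoulli (x : R) a : 0 <= x <= 1 -> 1 - a%:R * x <= (1 - x) ^+ a.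
Proof.
move=> /andP[x0 x1]; elim: a => [|a IH]; first by rewrite mul0r subr0.
have a0 : 0 <= a%:R :> R by [].
have ax : 0 <= a%:R * x ^+ 2 by rewrite mulr_ge0 // sqr_ge0.
by rewrite exprS -natr1; have := ler_wpM2l (_ : 0 <= 1 - x) IH; nra.
Qed.

(** The choice of t keeps both t d and t sqrt (u + d) at most 1/16: the sine of the
main term stays in its linear range, and cos (t/2)^u is at least 1/2. *)
Lemma sum_sin_num_ones_large (u d m : nat) : (100 <= d)%N -> (m < 2 ^ u)%N ->
  let t : R := (16 * Num.max d%:R (Num.sqrt (u + d)%:R))^-1 in
  2 ^+ u * (t * d%:R / 32) <=
  \sum_(x < 2 ^ u + m) sin (t * ((u + d)%:R / 2 - 1 - (num_ones x)%:R)).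
Proof.
move=> d100 mu; set M := Num.max _ _; set t := (16 * M)^-1 => /=.
have d100R : 100 <= d%:R :> R by rewrite (ler_nat _ 100).
have Md : d%:R <= M by rewrite le_max lexx.
have Ms : Num.sqrt (u + d)%:R <= M by rewrite le_max lexx orbT.
have M0 : 0 < M by lra.
have t0 : 0 < t by rewrite invr_gt0 mulr_gt0.
have tM : t * M = 1 / 16 by rewrite /t; field; rewrite gt_eqF.
have td : t * d%:R <= 1 / 16 by rewrite -tM ler_pM2l.
have tu : t ^+ 2 * u%:R <= 1 / 256.
  have : t * Num.sqrt (u + d)%:R <= 1 / 16 by rewrite -tM ler_pM2l.
  have : 0 <= Num.sqrt (u + d)%:R :> R by rewrite sqrtr_ge0.
  have : Num.sqrt (u + d)%:R ^+ 2 = u%:R + d%:R :> R by rewrite sqr_sqrtr // natrD.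
  move: (Num.sqrt _) => s ss s0 ts.
  have : (t * s) ^+ 2 <= (1 / 16) ^+ 2.
    by rewrite lerXn2r ?nnegrE ?pmulr_rge0.
  have := sqr_ge0 t; rewrite exprMn ss; nra.
have t1 : t <= 1 by nra.
rewrite (sum_num_ones_top (fun j => sin (t * ((u + d)%:R / 2 - 1 - j%:R)))) ?(ltnW mu) //.
set b : R := (u + d)%:R / 2 - 1.
under [X in _ <= _ + X]eq_bigr do rewrite -natr1 opprD addrCA addrC.
have t01 : 0 < t <= 1 by rewrite t0.
apply: le_trans (lerD (lexx _) (sum_sin_num_ones_ge (b - 1) t01 mu)).
rewrite sum_sin_num_ones_pow2.
have -> : b - u%:R / 2 = d%:R / 2 - 1 by rewrite /b natrD; lra.
have -> : b - 1 - u%:R / 2 = d%:R / 2 - 2 by rewrite /b natrD; lra.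
have -> : negpart (d%:R / 2 - 2) = 0 by apply/max_idPl; lra.
rewrite exprMn -[2 ^+ u * _ * _]mulrA -(mulrN (2 ^+ u)) -mulrDr.
rewrite ler_pM2l ?exprn_gt0 //.
(* The variance of the first block is harmless: u t^2 is at most 1/256. *)
have cosu : 1 / 2 <= cos (t / 2) ^+ u.
  have t8 : 0 <= t ^+ 2 / 8 <= 1 by have := sqr_ge0 t; nra.
  apply: (@le_trans _ _ ((1 - t ^+ 2 / 8) ^+ u)).
    by apply: le_trans (bernoulli u t8); lra.
  have cge : 1 - t ^+ 2 / 8 <= cos (t / 2).
    by apply: le_trans (cos_ge_quadratic _); lra.
  by rewrite lerXn2r // nnegrE; lra.
set y := t * (d%:R / 2 - 1).
have y0 : 0 <= y by rewrite mulr_ge0 ?(ltW t0) //; lra.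
have siny : y / 2 <= sin y.
  have y2 : y <= 1 / 2 by rewrite /y; lra.
  by apply: le_trans (sin_ge_quadratic y0); nra.
(* Main term of the first block; the rest costs at most t (2 t (d/2 - 2)^2 + 5). *)
have main : y / 4 <= cos (t / 2) ^+ u * sin y by nra.
apply: le_trans (lerD main (lexx _)).
have : t * (d%:R / 2 - 2) ^+ 2 <= d%:R / 64 by nra.
by rewrite /y; nra.
Qed.

End LowerBound.

(** * Total variation distance as a supremum over test functions *)

Section TotalVariation.
Context {R : realType}.

Lemma law_XE n k : (0 < n)%N ->
  law_X R n [set k]%classic = (n%:R^-1 * \sum_(x < n) (num_ones x == k)%:R)%:E.
Proof.
case: n => // n _; rewrite /law_X /distribution /pushforward /uniform_below /=.
rewrite EFinM; congr (_ * _)%E; rewrite -sumEFin; apply: eq_bigr => x _.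
by rewrite diracE (_ : (_ \in _) = (num_ones x == k)) //; apply/idP/eqP; rewrite inE.
Qed.

Lemma law_YE L k : law_Y R L [set k]%classic = (2 ^- L * 'C(L, k)%:R)%:E.
Proof.
rewrite /law_Y /= /binomial_prob ifT; last by rewrite invr_ge0 ler0n /= invf_le1 // ler1n.
have half : unstable.onem (2^-1 : R) = 2^-1 by rewrite /unstable.onem; lra.
rewrite esum_set1; last by rewrite lee_fin binomial_pmf_ge0 // invr_ge0 ler0n /= invf_le1 // ler1n.
rewrite /binomial_pmf half; congr (_%:E).
have [kL|Lk] := leqP k L; last by rewrite bin_small // mulr0n mulr0.
by rewrite -exprD subnKC // exprVn -mulr_natr.
Qed.

Lemma dTV_finite (mu nu : probability nat R) (p q : nat -> R) K :
  (forall k, mu [set k]%classic = (p k)%:E) ->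
  (forall k, nu [set k]%classic = (q k)%:E) ->
  (forall k, (K <= k)%N -> p k = q k) ->
  dTV mu nu = (2^-1 * \sum_(k < K) `|p k - q k|)%:E.
Proof.
move=> muE nuE tail; rewrite /dTV.
have termE k : `|mu [set k]%classic - nu [set k]%classic|%E = `|p k - q k|%:E.
  by rewrite muE nuE.
under eq_eseriesr do rewrite termE.
rewrite (nneseries_split 0 K) //= add0n eseries0 ?adde0.
  by rewrite big_mkord sumEFin -EFinM.
by move=> k Kk _; rewrite tail // subrr normr0.
Qed.

(** E f(X_n) - E f(Y_L), with the constant E f(Y_L) moved inside the average so that
blocks on which the two means agree cancel. *)
Definition mean_gap n L (f : nat -> R) : R :=
  n%:R^-1 * \sum_(x < n) (f (num_ones x) - binom_mean L f 0).

Let p n (k : nat) : R := n%:R^-1 * \sum_(x < n) (num_ones x == k)%:R.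
Let q L k : R := 2 ^- L * 'C(L, k)%:R.

Let sum_gap n L (f : nat -> R) : (0 < n)%N ->
  \sum_(k < n + L.+1) f k * (p n k - q L k) = mean_gap n L f.
Proof.
move=> n0; under eq_bigr do rewrite mulrBr.
rewrite sumrB /mean_gap sumrB sumr_const card_ord mulrBr -[binom_mean _ _ _ *+ n]mulr_natl.
rewrite mulrA mulVf ?pnatr_eq0 -?lt0n // mul1r; congr (_ - _).
  under eq_bigr do rewrite /p mulrCA mulr_sumr.
  rewrite -mulr_sumr exchange_big /=; congr (_ * _); apply: eq_bigr => x _.
  have xK : (num_ones x < n + L.+1)%N.
    by rewrite ltn_addr // (leq_ltn_trans (num_ones_leq x)).
  rewrite (bigD1 (Ordinal xK)) //= eqxx mulr1 big1 ?addr0 // => k.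
  by rewrite -val_eqE /= eq_sym => /negbTE ->; rewrite mulr0.
rewrite binom_meanE mulr_sumr addnC big_split_ord /= [X in _ + X]big1 ?addr0.
  by apply: eq_bigr => k _; rewrite /q mulrC -mulrA.
by move=> k _; rewrite /q bin_small ?mulr0 // ltn_addr.
Qed.

Let dTV_lawE n L : (0 < n)%N ->
  dTV (law_X R n) (law_Y R L) = (2^-1 * \sum_(k < n + L.+1) `|p n k - q L k|)%:E.
Proof.
move=> n0; apply: dTV_finite => [k|k|k Kk]; [exact: law_XE|exact: law_YE|].
rewrite /q bin_small ?mulr0; last by apply: leq_trans Kk; rewrite leq_addl.
rewrite /p big1 ?mulr0 // => x _; rewrite ltn_eqF //.
apply: leq_ltn_trans (num_ones_leq x) _; apply: leq_trans (ltn_ord x) _.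
by apply: leq_trans Kk; rewrite leq_addr.
Qed.

Lemma dTV_ge_mean_gap n L (f : nat -> R) : (0 < n)%N -> (forall j, `|f j| <= 1) ->
  ((2^-1 * mean_gap n L f)%:E <= dTV (law_X R n) (law_Y R L))%E.
Proof.
move=> n0 f1; rewrite dTV_lawE // -sum_gap // lee_fin ler_pM2l ?invr_gt0 //.
apply: ler_sum => k _; apply: le_trans (ler_norm _) _.
by rewrite normrM ler_piMl.
Qed.

(** The extremal test function is the sign of the difference of the two laws. *)
Lemma dTV_le_mean_gap n L (B : R) : (0 < n)%N ->
  (forall f, (forall j, `|f j| <= 1) -> mean_gap n L f <= B) ->
  (dTV (law_X R n) (law_Y R L) <= (2^-1 * B)%:E)%E.
Proof.
move=> n0 gapB; rewrite dTV_lawE // lee_fin ler_pM2l ?invr_gt0 //.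
have sg1 j : `|Num.sg (p n j - q L j)| <= 1 by rewrite normr_sg; case: eqP.
apply: le_trans (gapB _ sg1); rewrite -sum_gap // ler_sum // => k _.
by rewrite normrEsg.
Qed.

(** The first 2^L integers reproduce E f(Y_L) exactly, so they drop out. *)
Lemma mean_gap_top L m (f : nat -> R) : (m <= 2 ^ L)%N ->
  mean_gap (2 ^ L + m) L f =
  (2 ^ L + m)%:R^-1 * \sum_(x < m) (f (1 + num_ones x)%N - binom_mean L f 0).
Proof.
move=> mL; rewrite /mean_gap (sum_num_ones_top (fun j => f j - binom_mean L f 0)) //.
rewrite [X in X + _](_ : _ = 0) ?add0r //.
rewrite sumrB (sum_num_ones_pow2 L f 0) sumr_const card_ord.
by rewrite -[binom_mean _ _ _ *+ _]mulr_natl natrX subrr.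
Qed.

End TotalVariation.

(** * The two-sided bound *)

Section TwoSidedBound.
Context {R : realType}.

Definition tv_rate (u d : nat) : R :=
  (2 ^+ d)^-1 * Num.min 1 (d%:R / Num.sqrt (u + d)%:R).

(** The argument 1 of the minimum comes from bounding each of the m terms by 2, the
other one from [num_ones_discrepancy]. *)
Lemma dTV_upper (u d m : nat) : (3 <= d)%N -> (m < 2 ^ u.+1)%N ->
  (dTV (law_X R (2 ^ (u + d) + m)) (law_Y R (u + d)) <= (4 * tv_rate u d)%:E)%E.
Proof.
move=> d3 mu; set L := (u + d)%N.
have L0 : (0 < L)%N by rewrite /L; lia.
have uL : (u.+1 <= L)%N by rewrite /L; lia.
have mL : (m <= 2 ^ L)%N.
  by rewrite (leq_trans (ltnW mu)) // leq_exp2l.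
have n0 : (0 < 2 ^ L + m)%N by rewrite addn_gt0 expn_gt0.
have s0 : 0 < Num.sqrt L%:R :> R by rewrite sqrtr_gt0 ltr0n.
have -> : 4 * tv_rate u d = 2^-1 * (8 * tv_rate u d) by lra.
apply: dTV_le_mean_gap => // f f1; rewrite mean_gap_top //.
set S := \sum_(x < m) _.
have SL : S <= 2 ^+ u * (8 * (d%:R / Num.sqrt L%:R)).
  apply: le_trans (ler_norm _) _.
  apply: le_trans (num_ones_discrepancy 1 L0 f1 uL mu) _.
  rewrite exprSr -mulrA ler_pM2l ?exprn_gt0 // !mulrA ler_pM2r ?invr_gt0 //.
  by rewrite -!natrM ler_nat /L; lia.
have S1 : S <= 2 ^+ u * 8.
  have M1 : `|binom_mean L f 0| <= 1.
    by rewrite -[leRHS](binom_mean_cst L 1 0) norm_binom_mean_le.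
  apply: (@le_trans _ _ (\sum_(x < m) 2)).
    apply: ler_sum => x _; have := f1 (1 + num_ones x)%N.
    by move: M1; rewrite !ler_norml; lra.
  rewrite sumr_const card_ord -[_ *+ m]mulr_natl.
  have m2 : m%:R <= 2 * 2 ^+ u :> R by rewrite -exprS -natrX ler_nat ltnW.
  have pow0 : 0 < 2 ^+ u :> R by rewrite exprn_gt0.
  by lra.
have Srate : S <= 2 ^+ L * (8 * tv_rate u d).
  rewrite /tv_rate -/L mulrCA /L exprD -[_ * 2 ^+ d * _]mulrA mulVKf ?expf_neq0 //.
  by rewrite mulrCA; case: (leP 1 (d%:R / _)) => _; rewrite ?mulr1 // mulrCA.
have rate0 : 0 <= 8 * tv_rate u d.
  have min0 : 0 <= Num.min 1 (d%:R / Num.sqrt L%:R) :> R.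
    by rewrite le_min ler01 divr_ge0 // ltW.
  by rewrite mulr_ge0 // mulr_ge0 // invr_ge0 exprn_ge0.
rewrite mulrC ler_pdivrMr ?ltr0n // mulrC; apply: le_trans Srate _.
by rewrite ler_wpM2r // -natrX ler_nat leq_addr.
Qed.

(** The test function is odd about L/2, so its binomial mean vanishes; then
[sum_sin_num_ones_large] applies to the remaining m integers. *)
Lemma dTV_lower (u d m : nat) : (100 <= d)%N -> (2 ^ u <= m)%N -> (m < 2 ^ u.+1)%N ->
  (((2 ^+ 11)^-1 * tv_rate u d)%:E <= dTV (law_X R (2 ^ (u + d) + m)) (law_Y R (u + d)))%E.
Proof.
move=> d100 um mu; set L := (u + d)%N.
have L0 : (0 < L)%N by rewrite /L; lia.
have mL : (m <= 2 ^ L)%N.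
  by rewrite (leq_trans (ltnW mu)) // leq_exp2l // /L; lia.
have n0 : (0 < 2 ^ L + m)%N by rewrite addn_gt0 expn_gt0.
have s0 : 0 < Num.sqrt L%:R :> R by rewrite sqrtr_gt0 ltr0n.
have d0 : 0 < d%:R :> R by rewrite ltr0n; lia.
pose t : R := (16 * Num.max d%:R (Num.sqrt L%:R))^-1.
pose f (j : nat) : R := sin (t * (L%:R / 2 - j%:R)).
have f1 j : `|f j| <= 1 by rewrite sin_max.
apply: le_trans (dTV_ge_mean_gap L n0 f1); rewrite lee_fin mean_gap_top //.
have -> : binom_mean L f 0 = 0.
  apply: (mulfI (_ : 2 ^+ L != 0)); first by rewrite expf_neq0.
  rewrite -sum_num_ones_pow2 /f sum_sin_num_ones_pow2 subrr mulr0 sin0.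
  by rewrite !mulr0.
under eq_bigr do rewrite subr0 /f natrD opprD addrA.
have m'u : (m - 2 ^ u < 2 ^ u)%N by rewrite ltn_subLR // addnn -mul2n -expnS.
have := sum_sin_num_ones_large (R := R) d100 m'u.
rewrite subnKC // -/L -/t => /= large.
(* The frequency is chosen so that t d is the wanted minimum, up to 1/16. *)
have td : t * d%:R = 16^-1 * Num.min 1 (d%:R / Num.sqrt L%:R).
  rewrite /t invfM -mulrA; congr (_ * _).
  have [ds|sd] := leP d%:R (Num.sqrt L%:R).
    by rewrite min_r ?ler_pdivrMr ?mul1r // mulrC.
  by rewrite min_l ?mulVf ?gt_eqF // ler_pdivlMr // mul1r ltW.
rewrite td in large; rewrite /tv_rate -/L.
move: large; set mn := Num.min _ _ => large.
have mn0 : 0 <= mn by rewrite le_min ler01 divr_ge0 // ltW.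
rewrite [2 ^+ 11]exprS invfM -[2^-1 * _ * _]mulrA.
rewrite ler_pM2l ?invr_gt0 // mulrC [leRHS]mulrC ler_pdivlMr ?ltr0n //.
apply: le_trans large.
have nn : (2 ^ L + m)%:R <= 2 * (2 ^+ u * 2 ^+ d) :> R.
  by rewrite -exprD -exprS -natrX ler_nat expnS mul2n -addnn leq_add2l.
have coef0 : 0 <= (2 ^+ d)^-1 * mn * (2 ^+ 10)^-1.
  by rewrite mulr_ge0 ?mulr_ge0 ?invr_ge0 ?exprn_ge0.
apply: le_trans (ler_wpM2l coef0 nn) _.
rewrite le_eqVlt; apply/orP; left; apply/eqP.
by field; rewrite expf_neq0.
Qed.

End TwoSidedBound.

Theorem theorem2p4 (R : realType) :
  exists2 c : R, 0 < c &
  exists C1 C2 : R, [/\ 0 < C1, 0 < C2 &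
  forall (n : nat) (l : seq nat),
    (0 < n)%N ->
    binary_exponents n l ->
    (2 <= size l)%N ->
    let lambda := nth 0%N l 0 in
    let lambda2 := nth 0%N l 1 in
    c <= lambda%:R - lambda2%:R ->
    let rate : R := (2 ^+ (lambda - lambda2))^-1 *
      Num.min 1 ((lambda%:R - lambda2%:R) / Num.sqrt lambda%:R) in
    ((C1 * rate)%:E <= dTV (law_X R n) (law_Y R lambda) <= (C2 * rate)%:E)%E].
Proof.
exists 100 => //; exists (2 ^+ 11)^-1, 4; split=> // n [|a [|u l]] // _ [srt ->] _ /=.
case/andP: (srt) => ua srt2.
rewrite -natrB ?(ltnW ua) // (ler_nat _ 100) => d100.
set d := (a - u)%N in d100 *.
have -> : a = (u + d)%N by rewrite /d subnKC // ltnW.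
rewrite !big_cons addnA -addnA.
have lu : (\sum_(i <- l) 2 ^ i < 2 ^ u)%N by exact: top_exponent_bound.
have mu : (2 ^ u + \sum_(i <- l) 2 ^ i < 2 ^ u.+1)%N.
  by rewrite expnS mul2n -addnn ltn_add2l.
by rewrite dTV_lower ?dTV_upper ?leq_addr //; lia.
Qed.
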